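(* Let $d\ge 1$ and let $(X,\mathcal{B},\mu,T)$ be a non-trivial invertible probability measure preserving system on a standard probability space which is mixing of order $d+1$. Let $(c_{i,n})_{n\in\mathbb{Z}}$, $1\leq i\leq d$, be integer sequences such that $\lim_{|n|\to\infty}|c_{i,n}|=\infty$ for all $1\le i\le d$ and $\lim_{|n|\to\infty}|c_{j,n}-c_{i,n}|=\infty$ for all $1\leq i<j\leq d$. Then there is $A\in\mathcal{B}$ such that $$\mu(A\cap T^{c_{1,n}}A\cap\dots\cap T^{c_{d,n}}A)>\mu(A)^{d+1}$$ for all $n\in\mathbb{Z}$.
   Context: An invertible probability measure preserving system $(X,\mathcal{B},\mu,T)$ is mixing of order $d+1$ if for all $A\in\mathcal{B}$ and all integer sequences $(c_{i,n})_{n\in\mathbb{Z}}$, $1\leq i\leq d$, such that $\lim_{|n|\to\infty}|c_{i,n}|=\infty$ for all $1\le i\le d$ and $\lim_{|n|\to\infty}|c_{i,n}-c_{j,n}|=\infty$ for all $1\leq i<j\leq d$, one has $$\lim_{|n|\to\infty}\mu(A\cap T^{c_{1,n}}A\cap\dots\cap T^{c_{d,n}}A)=\mu(A)^{d+1}.$$ A standard probability space is one isomorphic mod $0$ to a disjoint union of finitely many atoms with an interval equipped with Lebesgue measure. Non-trivial means that $\mathcal{B}$ contains a set of measure strictly between $0$ and $1$. *)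

(* Defs.v *)
From HB Require Import structures.
From mathcomp Require Import all_boot all_order all_algebra.
From mathcomp Require Import all_classical all_reals all_analysis.

Set Implicit Arguments.
Unset Strict Implicit.
Unset Printing Implicit Defensive.

Import Order.TTheory GRing.Theory Num.Theory.
Import numFieldNormedType.Exports.

Local Open Scope classical_set_scope.
Local Open Scope ring_scope.

(* The filter of the limits "as |n| tends to infinity", n ranging over the
   integers of both signs. *)
Definition absz_infty : set_system int :=
  filter_from [set: nat] (fun N => [set n : int | (N <= absz n)%N]).

Global Instance absz_infty_filter : ProperFilter absz_infty.
Proof.
apply: filter_from_proper; last by move=> N _; exists N%:Z => /=.
apply: filter_from_filter; first by exists 0%N.
move=> M N _ _; exists (maxn M N) => // n /=.
by rewrite geq_max => /andP[].
Qed.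

Definition dispersing (d : nat) (c : 'I_d -> int -> int) : Prop :=
  (forall i, absz (c i n) @[n --> absz_infty] --> \oo) /\
  (forall i j : 'I_d, (i < j)%N ->
     absz (c j n - c i n) @[n --> absz_infty] --> \oo).

(* T^m A for an integer m.  The intended T is a bijection, so that for m < 0
   the image of A under T^m is its preimage under the iterate T^|m|. *)
Definition shift_set (X : Type) (T : X -> X) (m : int) (A : set X) : set X :=
  match m with
  | Posz k => iter k T @` A
  | Negz k => iter k.+1 T @^-1` A
  end.

Definition multi_return (X : Type) (T : X -> X) (d : nat) (m : 'I_d -> int)
    (A : set X) : set X :=
  A `&` \bigcap_(i in [set: 'I_d]) shift_set T (m i) A.

Record invertible_mps (disp : measure_display) (X : measurableType disp)
    (R : realType) (mu : probability X R) (T : X -> X) : Prop := InvertibleMps {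
  mps_bij : bijective T;
  mps_measurable : measurable_fun [set: X] T;
  mps_measurable_inv : forall A : set X, measurable A -> measurable (T @` A);
  mps_preserving : forall A : set X, measurable A -> mu (T @^-1` A) = mu A
}.

(* Mixing of order k.  It is only meaningful for k = d + 1 with d >= 1, where it
   involves d integer sequences; as in the source, one and the same set A is
   used throughout. *)
Definition mixing_of_order (disp : measure_display) (X : measurableType disp)
    (R : realType) (mu : probability X R) (T : X -> X) (k : nat) : Prop :=
  forall (A : set X) (c : 'I_k.-1 -> int -> int),
    measurable A -> dispersing c ->
    mu (multi_return T (c^~ n) A) @[n --> absz_infty] --> (mu A ^+ k)%E.

Definition nontrivial_measure (disp : measure_display) (X : measurableType disp)
    (R : realType) (mu : probability X R) : Prop :=
  exists A : set X, measurable A /\ (0 < mu A < 1)%E.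

(* Isomorphism mod 0: a bijection between conull sets that respects, in both
   directions, the measurable sets of the completions and their measures.  (A
   set belongs to the completion of nu iff it differs from some measurable set
   B by a negligible set, and then its completed measure is nu B.)  Passing to
   completions makes the notion independent of whether the sigma-algebras,
   e.g. Borel versus Lebesgue sets of an interval, are complete. *)
Definition isomorphic_mod0 (R : realType)
    (d1 d2 : measure_display) (X : measurableType d1) (Y : measurableType d2)
    (mu : {measure set X -> \bar R}) (nu : {measure set Y -> \bar R}) : Prop :=
  exists (X' : set X) (Y' : set Y) (phi : X -> Y),
    [/\ mu.-negligible (~` X'), nu.-negligible (~` Y'), set_bij X' Y' phi,
        (forall A, measurable A -> exists B, [/\ measurable B, nu B = mu A &
           nu.-negligible ((phi @` (X' `&` A)) `+` B)]) &
        (forall B, measurable B -> exists A, [/\ measurable A, mu A = nu B &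
           mu.-negligible ((X' `&` phi @^-1` B) `+` A)])].

(* The disjoint union of the interval I, with Lebesgue measure, and of atoms of
   mass p i, i < k, is realized on the real line by placing the atoms at
   distinct points a i outside I. *)
Definition interval_atoms (R : realType) (I : interval R) (k : nat)
    (a : nat -> R) (p : nat -> {posnum R}) :
    {measure set (measurableTypeR R) -> \bar R} :=
  measure_add
    (mrestr lebesgue_measure
       (measurable_itv I : measurable ([set` I] : set (measurableTypeR R))))
    (msum (fun i => mscale (p i)%:num%:nng
                      (dirac (a i : measurableTypeR R))) k).

Definition standard_probability_space (disp : measure_display)
    (X : measurableType disp) (R : realType) (mu : probability X R) : Prop :=
  exists (I : interval R) (k : nat) (a : nat -> R) (p : nat -> {posnum R}),
    [/\ set_inj `I_k a, (forall i, (i < k)%N -> a i \notin I) &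
        isomorphic_mod0 mu (interval_atoms I k a p)].

(* Main.v *)
Require Import Defs.
From HB Require Import structures.
From mathcomp Require Import all_boot all_order all_algebra.
From mathcomp Require Import all_classical all_reals all_analysis.
From mathcomp Require Import lra zify.

Set Implicit Arguments.
Unset Strict Implicit.
Unset Printing Implicit Defensive.

Import Order.TTheory GRing.Theory Num.Theory.
Import numFieldNormedType.Exports.

Local Open Scope classical_set_scope.
Local Open Scope ring_scope.

(** Write R_n(A) for the intersection of A with the sets T^(c_(i,n)) A.  By
mixing, mu(R_n(A)) is close to mu(A)^(d+1) for large |n|; the set A has to be
arranged so that the error is always strictly in its favour.

The set is an increasing union of stages A_0 = set0, A_1, A_2, ... of total
measure so small that x |-> x^(d+1) has a tiny slope (at most 1/16) on the
range of measures involved.  The stage A_(k+1) adds to A_k at most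
eps_k = e / 2^k of measure, in the form of a set that looks invariant for a very
long time: for every n below a threshold M_k, chosen after A_k, at least half of
eps_k lies in R_n(A_(k+1)) outside of A_k.  The threshold is such that A_k is
already mixed beyond it: mu(R_n(A_k)) is at least mu(A_k)^(d+1) up to eps_k / 16
when |n| >= M_k.

Given n, let k be least with |n| < M_k.  If k > 0, then R_n(A) contains two
disjoint pieces: R_n(A_(k-1)), of measure almost mu(A_(k-1))^(d+1) because n is
beyond M_(k-1), and the piece of measure eps_k / 2 obtained at stage k+1.  On the
other side, mu(A) exceeds mu(A_(k-1)) by at most 2 eps_(k-1) = 4 eps_k, which
moves the (d+1)-th power by at most eps_k / 4.  The constant gain thus beats
both losses.  For k = 0 the first piece is empty and the same count works.  No
independence between the new set and the old stages is ever used, which is why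
the argument is the same for all d ([enlargement_step] and the theorem).

The almost invariant sets are the unions of T^m D over |m| <= h, for D of tiny
positive measure ([exists_sweep]).  As h grows, the measure outside of A_k
increases by at most 2 mu(D) at a time and tends to that of the complement of
A_k, the orbit of D being conull by ergodicity; so it can be stopped just above
eps_k / 2, and a further bounded number L of steps remains below eps_k.  The
translates up to time L of the set reached after these further steps all contain
the set reached before them.  Sets D of arbitrarily small positive
measure come from the mixing itself, since B |-> R_n(B) turns the measure b into
about b^(d+1) ([exists_small_set]). *)

(** * Translates of a set under a bijection *)

Section ShiftSet.
Context (X : Type) (T : X -> X).

(** The map T^(-m), for S the inverse of T; it turns all the sets T^m A, with m of
either sign, into preimages. *)
Definition back_flow (S : X -> X) (m : int) : X -> X :=
  match m with Posz k => iter k S | Negz k => iter k.+1 T end.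

Lemma back_flowD (S : X -> X) (m n : int) : cancel T S -> cancel S T ->
  back_flow S (m + n) =1 back_flow S m \o back_flow S n.
Proof.
move=> TK SK.
have flowS (p : int) x : back_flow S (p + 1) x = S (back_flow S p x).
  case: p => [k|[|k]]; first by rewrite -PoszD addn1.
    by rewrite /= TK.
  by rewrite (_ : Negz k.+1 + 1 = Negz k); [rewrite [in RHS]/= TK|lia].
have flowP (p : int) x : back_flow S (p - 1) x = T (back_flow S p x).
  by rewrite -[in RHS](subrK 1 p) flowS SK.
elim/int_rec: m => [|k IH|k IH] x; first by rewrite add0r.
  rewrite (_ : k.+1%:Z + n = k%:Z + n + 1); last by lia.
  by rewrite flowS IH.
rewrite (_ : - k.+1%:Z + n = - k%:Z + n - 1); last by lia.
rewrite flowP IH /comp -flowP (_ : - k%:Z - 1 = - k.+1%:Z) //; lia.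
Qed.

Lemma shift_setE (S : X -> X) (m : int) (A : set X) :
  cancel T S -> cancel S T -> shift_set T m A = back_flow S m @^-1` A.
Proof.
move=> TK SK; case: m => // k /=.
have iterK (f g : X -> X) : cancel f g -> cancel (iter k f) (iter k g).
  move=> fK; elim: k => // j IH x.
  by rewrite iterSr iterS fK IH.
apply/seteqP; split=> [_ [x Ax <-]|x Ax] /=; first by rewrite iterK.
by exists (iter k S x) => //; exact: iterK.
Qed.

Hypothesis Tbij : bijective T.

Lemma shift_setD (m n : int) (A : set X) :
  shift_set T m (shift_set T n A) = shift_set T (m + n) A.
Proof.
have [S TK SK] := Tbij; rewrite !(shift_setE _ _ TK SK).
by apply/funext => x /=; rewrite addrC back_flowD.
Qed.

Lemma shift_set_bigcup (I : Type) (P : set I) (F : I -> set X) (m : int) :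
  shift_set T m (\bigcup_(i in P) F i) = \bigcup_(i in P) shift_set T m (F i).
Proof.
have [S TK SK] := Tbij; rewrite (shift_setE _ _ TK SK) preimage_bigcup.
by apply: eq_bigcupr => i _; rewrite (shift_setE _ _ TK SK).
Qed.

Lemma shift_setS (m : int) (A B : set X) :
  A `<=` B -> shift_set T m A `<=` shift_set T m B.
Proof.
have [S TK SK] := Tbij.
by move=> AB; rewrite !(shift_setE _ _ TK SK); exact: preimage_subset.
Qed.

Lemma multi_returnS d (m : 'I_d -> int) (A B : set X) :
  A `<=` B -> multi_return T m A `<=` multi_return T m B.
Proof.
move=> AB x [Ax rx]; split; first exact: AB.
by move=> i _; apply: shift_setS AB _ (rx i I).
Qed.

Lemma multi_return_invariant d (m : 'I_d -> int) (V : set X) :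
  (forall p, shift_set T p V = V) -> multi_return T m V = V.
Proof.
move=> VI; apply/seteqP; split=> [x []//|x Vx]; split=> // i _.
by rewrite VI.
Qed.

(** The union of the sets T^m D over |m| <= h.  Being two-sided, it makes the
union over all h exactly invariant, and not only up to a null set. *)
Definition sweep (h : nat) (D : set X) : set X :=
  \bigcup_(m in [set m : int | (absz m <= h)%N]) shift_set T m D.

Lemma sweep0 (D : set X) : sweep 0 D = D.
Proof.
apply/seteqP; split => [x [m /=]|x Dx]; last by exists 0 => //=; exists x.
by rewrite leqn0 absz_eq0 => /eqP -> [y Dy <-].
Qed.

Lemma sweepS (h : nat) (D : set X) :
  sweep h.+1 D =
  sweep h D `|` (shift_set T h.+1 D `|` shift_set T (- h.+1%:Z) D).
Proof.
apply/seteqP; split => [x [m /= mh Dx]|x [[m /= mh Dx]|[Dx|Dx]]].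
- have [mle|mgt] := leqP (absz m) h; first by left; exists m.
  have [e|e] : m = h.+1 \/ m = - h.+1%:Z by lia.
    by right; left; move: Dx; rewrite e.
  by right; right; move: Dx; rewrite e.
- by exists m => //=; exact: leqW.
- by exists h.+1%:Z => /=.
- by exists (- h.+1%:Z) => //=; rewrite abszN.
Qed.

Lemma subset_sweep (h k : nat) (D : set X) :
  (h <= k)%N -> sweep h D `<=` sweep k D.
Proof. by move=> hk x [m /= mh Dx]; exists m => //=; exact: leq_trans hk. Qed.

(** This is the sense in which a long sweep looks invariant: if T^p D has
|p| <= h, then T^p D = T^(m_i) (T^(p - m_i) D) with |p - m_i| <= h + L. *)
Lemma sweep_multi_return d (m : 'I_d -> int) (h L : nat) (D : set X) :
  (forall i, (absz (m i) <= L)%N) ->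
  sweep h D `<=` multi_return T m (sweep (h + L) D).
Proof.
move=> mL x Dx; split; first exact: subset_sweep (leq_addr _ _) _ Dx.
move=> i _; case: Dx => p /= ph Dx; rewrite shift_set_bigcup.
exists (p - m i) => /=; first by have := mL i; lia.
by rewrite shift_setD addrC subrK.
Qed.

Lemma shift_orbit (m : int) (D : set X) :
  shift_set T m (\bigcup_h sweep h D) = \bigcup_h sweep h D.
Proof.
have sub p : shift_set T p (\bigcup_h sweep h D) `<=` \bigcup_h sweep h D.
  rewrite shift_set_bigcup => x [h _]; rewrite shift_set_bigcup.
  move=> [q /= qh]; rewrite shift_setD => Dx.
  by exists (absz (p + q)) => //; exists (p + q) => /=.
apply/seteqP; split=> // x Vx.
have := shift_setS (m := m) (sub (- m)); rewrite shift_setD addrN; apply.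
by exists x.
Qed.

End ShiftSet.

(** * Probabilities as real numbers *)

Section RealProbability.
Context (disp : measure_display) (X : measurableType disp) (R : realType)
  (mu : probability X R).
Local Notation pr A := (fine (mu A)).
Implicit Types A B : set X.

Lemma prE A : measurable A -> mu A = (pr A)%:E.
Proof. by move=> mA; rewrite fineK// fin_num_measure. Qed.

Lemma pr_ge0 A : 0 <= pr A.
Proof. exact: fine_ge0. Qed.

Lemma pr_le1 A : measurable A -> pr A <= 1.
Proof. by move=> mA; rewrite -lee_fin -prE// probability_le1. Qed.

Lemma pr_subset A B : measurable A -> measurable B -> A `<=` B -> pr A <= pr B.
Proof.
move=> mA mB AB; rewrite -lee_fin -!prE//.
by apply: le_measure => //; rewrite inE.
Qed.

Lemma pr_setU_le A B : measurable A -> measurable B ->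
  pr (A `|` B) <= pr A + pr B.
Proof.
move=> mA mB; rewrite -lee_fin EFinD -!prE//; first exact: measureU2.
exact: measurableU.
Qed.

Lemma pr_setU_disjoint A B : measurable A -> measurable B ->
  A `&` B = set0 -> pr (A `|` B) = pr A + pr B.
Proof.
move=> mA mB AB0; apply/EFin_inj; rewrite EFinD -!prE//; first exact: measureU.
exact: measurableU.
Qed.

Lemma pr_setD A B : measurable A -> measurable B -> A `<=` B ->
  pr B = pr A + pr (B `\` A).
Proof.
move=> mA mB AB; rewrite -pr_setU_disjoint//; first by rewrite setDUK.
- exact: measurableD.
- by rewrite setDIK.
Qed.

Lemma pr_bigcup_cvg (F : nat -> set X) : (forall k, measurable (F k)) ->
  nondecreasing_seq F -> pr (F k) @[k --> \oo] --> pr (\bigcup_k F k).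
Proof.
move=> mF ndF; apply: fine_cvg; rewrite -prE; last exact: bigcupT_measurable.
by apply: nondecreasing_cvg_mu => //; exact: bigcupT_measurable.
Qed.

End RealProbability.

(** * Measure of translates and sweeps *)

Section Dynamics.
Context (disp : measure_display) (X : measurableType disp) (R : realType)
  (mu : probability X R) (T : X -> X).
Hypothesis mpsT : invertible_mps mu T.
Local Notation pr A := (fine (mu A)).
Implicit Types A B D : set X.

Let Tbij : bijective T := mps_bij mpsT.

Lemma measurable_mps_preimage A : measurable A -> measurable (T @^-1` A).
Proof.
move=> mA; rewrite -[_ @^-1` _]setTI.
exact: (mps_measurable mpsT).
Qed.

Lemma mps_measure_image A : measurable A -> mu (T @` A) = mu A.
Proof.
move=> mA; rewrite -(mps_preserving mpsT); last first.
  exact: (mps_measurable_inv mpsT).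
by congr (mu _); apply/funext => x /=; exact: (image_inj (bij_inj Tbij)).
Qed.

Lemma shift_set_measurable_measure (m : int) A : measurable A ->
  measurable (shift_set T m A) /\ mu (shift_set T m A) = mu A.
Proof.
have image k : measurable A ->
    measurable (iter k T @` A) /\ mu (iter k T @` A) = mu A.
  elim: k => [|k IH] mA; first by rewrite image_id.
  have [mI muI] := IH mA; rewrite -(image_comp (iter k T) T).
  by split; [exact: (mps_measurable_inv mpsT)|rewrite mps_measure_image].
have preimage k : measurable A ->
    measurable (iter k T @^-1` A) /\ mu (iter k T @^-1` A) = mu A.
  elim: k A {image} => [|k IH] A mA; first by rewrite preimage_id.
  have [mI muI] := IH _ (measurable_mps_preimage mA).
  by split => //; rewrite -(mps_preserving mpsT mA).
by case: m => k; [exact: image|exact: preimage].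
Qed.

Lemma measurable_shift_set (m : int) A :
  measurable A -> measurable (shift_set T m A).
Proof. by move=> mA; have [] := shift_set_measurable_measure m mA. Qed.

Lemma measure_shift_set (m : int) A :
  measurable A -> mu (shift_set T m A) = mu A.
Proof. by move=> mA; have [] := shift_set_measurable_measure m mA. Qed.

Lemma measurable_multi_return d (m : 'I_d -> int) A :
  measurable A -> measurable (multi_return T m A).
Proof.
move=> mA; apply: measurableI => //.
apply: fin_bigcap_measurable; first exact: finite_finset.
by move=> i _; exact: measurable_shift_set.
Qed.

Lemma measurable_sweep h D : measurable D -> measurable (sweep T h D).
Proof.
move=> mD; elim: h => [|h IH]; first by rewrite sweep0.
by rewrite sweepS; do 2 ?[apply: measurableU => //]; exact: measurable_shift_set.
Qed.

(** One more step adds only the two translates T^(h+1) D and T^(-h-1) D, hence at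
most 2 mu(D): the measure of a sweep grows slowly, inside or outside of A. *)
Lemma sweepS_le h D A : measurable D -> measurable A ->
  pr (sweep T h.+1 D `\` A) <= pr (sweep T h D `\` A) + 2 * pr D.
Proof.
move=> mD mA; rewrite sweepS setDUl.
have mS := measurable_shift_set _ mD.
apply: le_trans (pr_setU_le _ _ _) _.
- by apply: measurableD => //; exact: measurable_sweep.
- by apply: measurableD => //; exact: measurableU.
rewrite lerD2l.
apply: (@le_trans _ _ (pr (shift_set T h.+1 D `|` shift_set T (- h.+1%:Z) D))).
  apply: pr_subset => //.
  - by apply: measurableD => //; exact: measurableU.
  - exact: measurableU.
by apply: le_trans (pr_setU_le _ _ _) _ => //; rewrite !measure_shift_set// mulr_natl.
Qed.

Lemma sweepD_le h L D A : measurable D -> measurable A ->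
  pr (sweep T (h + L) D `\` A) <= pr (sweep T h D `\` A) + 2 * L%:R * pr D.
Proof.
move=> mD mA; elim: L => [|L IH]; first by rewrite addn0 mulr0 mul0r addr0.
rewrite addnS; apply: le_trans (sweepS_le _ mD mA) _.
by rewrite -(natr1 L); lra.
Qed.

End Dynamics.

(** * Two elementary bounds *)

(** The factor x, available because the exponent is at least 2, makes the slope of
the power small on small measures. *)
Lemma exprn_sub_le (R : realFieldType) (d : nat) (x y : R) :
  (0 < d)%N -> 0 <= y -> y <= x -> x <= 1 ->
  x ^+ d.+1 - y ^+ d.+1 <= d.+1%:R * x * (x - y).
Proof.
move=> d0 y0 yx x1; have x0 : 0 <= x by exact: le_trans yx.
rewrite subrXX mulrC ler_wpM2r ?subr_ge0//.
rewrite mulr_natl -[leRHS](_ : \sum_(i < d.+1) x = _); last first.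
  by rewrite sumr_const card_ord.
apply: ler_sum => i _.
apply: (@le_trans _ _ (x ^+ (d.+1.-1 - i) * x ^+ i)).
  by rewrite ler_wpM2l ?exprn_ge0// lerXn2r.
by rewrite -exprD subnK 1?leq_ord //= ler_iXnr.
Qed.

Lemma bounded_family (d : nat) (c : 'I_d -> int -> int) (M : nat) :
  exists L, forall n i, (absz n < M)%N -> (absz (c i n) <= L)%N.
Proof.
exists (\max_(i < d) \max_(j < M) maxn (absz (c i j)) (absz (c i (- j%:Z)))).
move=> n i nM.
apply: leq_trans (leq_bigmax i).
apply: leq_trans (leq_bigmax (Ordinal nM)) => /=.
have [e|e] : n = absz n \/ n = - (absz n)%:Z by lia.
  by rewrite leq_max -e leqnn.
by rewrite leq_max -e leqnn orbT.
Qed.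

(** * Consequences of mixing *)

Section Mixing.
Context (disp : measure_display) (X : measurableType disp) (R : realType)
  (mu : probability X R) (T : X -> X) (d : nat) (c : 'I_d -> int -> int).
Hypotheses (d_gt0 : (0 < d)%N) (mpsT : invertible_mps mu T)
  (mixT : mixing_of_order mu T d.+1) (dispc : dispersing c).
Local Notation pr A := (fine (mu A)).
Implicit Types A B D V : set X.

Lemma pr_multi_return_near A (e : R) : measurable A -> 0 < e ->
  exists N, forall n, (N <= absz n)%N ->
    `|pr (multi_return T (c^~ n) A) - pr A ^+ d.+1| < e.
Proof.
move=> mA e0; have := mixT mA dispc.
rewrite (prE mu mA) -EFin_expe => /fine_cvg /cvgrPdist_lt /(_ _ e0)[N _ NP].
by exists N => n Nn; rewrite distrC; exact: NP.
Qed.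

(** Ergodicity: an invariant V is equal to all its multiple returns, so that
mixing gives mu(V) = mu(V)^(d+1). *)
Lemma invariant_pr1 V : measurable V -> (forall p, shift_set T p V = V) ->
  0 < pr V -> pr V = 1.
Proof.
move=> mV VI V0; apply/eqP; rewrite eq_le pr_le1//= leNgt; apply/negP => V1.
have lt : pr V ^+ d.+1 < pr V.
  by rewrite exprS gtr_pMr// exprn_ilt1// ?pr_ge0// gtn_eqF.
have [|N /(_ N%:Z (leqnn _))] := @pr_multi_return_near V (pr V - pr V ^+ d.+1) mV.
  by rewrite subr_gt0.
by rewrite multi_return_invariant// ger0_norm ?ltxx// subr_ge0 ltW.
Qed.

(** Starting from a set of measure a < 1, some multiple return of a set of measure
b <= a has positive measure, as close as desired to b^(d+1) <= a b; it can hence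
be made smaller than r b, for the fixed ratio r = (1 + a) / 2 < 1. *)
Lemma exists_small_set (e : R) : nontrivial_measure mu -> 0 < e ->
  exists D, [/\ measurable D, 0 < pr D & pr D < e].
Proof.
move=> [A [mA /andP[A0 A1]]] e0.
set a := pr A; have a0 : 0 < a by rewrite -lte_fin -prE.
have a1 : a < 1 by rewrite -lte_fin -prE.
pose r : R := (1 + a) / 2.
have r0 : 0 < r by rewrite /r; lra.
have r1 : r < 1 by rewrite /r; lra.
have small k : exists B, [/\ measurable B, 0 < pr B & pr B <= a * r ^+ k].
  elim: k => [|k [B [mB B0 Bk]]]; first by exists A; rewrite expr0 mulr1.
  set b := pr B in B0 Bk.
  have ba : b <= a.
    by apply: le_trans Bk _; rewrite ger_pMr// exprn_ile1// ltW.
  have bd : b ^+ d.+1 <= a * b.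
    rewrite exprSr ler_pM2r//; apply: le_trans ba.
    by apply: ler_iXnr; rewrite ?(ltW B0) ?pr_le1.
  have b'0 : 0 < Num.min (b ^+ d.+1) (b * (1 - a) / 2).
    by rewrite lt_min exprn_gt0//= divr_gt0// mulr_gt0// subr_gt0.
  have [N /(_ N%:Z (leqnn _))] := pr_multi_return_near mB b'0.
  rewrite lt_min -/b !ltr_norml => /andP[/andP[lo _] /andP[_ hi]].
  exists (multi_return T (c^~ N%:Z) B); split.
  - exact: (measurable_multi_return mpsT).
  - by lra.
  - rewrite exprSr mulrA; apply: (@le_trans _ _ (b * r)); last by rewrite ler_pM2r.
    by rewrite /r; lra.
have /cvgrPdist_lt/(_ _ e0)[k _ /(_ k (leqnn _))] :
    a * r ^+ k @[k --> \oo] --> (0 : R).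
  rewrite -(mulr0 a); apply: cvgMr; apply: cvg_expr.
  by rewrite gtr0_norm.
rewrite sub0r normrN /= => ke; have [B [mB B0 Bk]] := small k.
exists B; split => //; apply: le_lt_trans Bk _; apply: le_lt_trans ke.
exact: ler_norm.
Qed.

(** A stopping-time argument: the first h at which the sweep of D has measure at
least e / 2 outside of A overshoots by at most 2 mu(D), and L further steps cost
at most 2 L mu(D); a D of measure below e / (4 (L + 1)) pays for both. *)
Lemma exists_sweep A (e : R) (L : nat) : nontrivial_measure mu ->
  measurable A -> pr A <= 1 / 2 -> 0 < e -> e < 1 ->
  exists h D, [/\ measurable D, e / 2 <= pr (sweep T h D `\` A) &
    pr (sweep T (h + L) D `\` A) <= e].
Proof.
move=> ntX mA A2 e0 e1.
have [D [mD D0 De]] : exists D, [/\ measurable D, 0 < pr D &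
    pr D < e / (4 * L.+1%:R)].
  by apply: exists_small_set => //; rewrite divr_gt0// mulr_gt0.
have mS h : measurable (sweep T h D) by exact: (measurable_sweep mpsT).
have mSA h : measurable (sweep T h D `\` A) by exact: measurableD.
pose V := \bigcup_h sweep T h D.
have mV : measurable V by exact: bigcupT_measurable.
have V1 : pr V = 1.
  apply: invariant_pr1 => // [p|].
    by apply: shift_orbit; exact: (mps_bij mpsT).
  apply: lt_le_trans D0 _; apply: pr_subset => // x Dx.
  by exists 0%N => //; rewrite sweep0.
have gain : e / 2 < pr (V `\` A).
  have : pr V <= pr (A `|` (V `\` A)).
    by rewrite setUDr setDv setD0; apply: pr_subset => //; exact: measurableU.
  have := pr_setU_le mu mA (measurableD mV mA).
  by rewrite V1; lra.
have exh : exists h, e / 2 <= pr (sweep T h D `\` A).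
  have cv : pr (sweep T h D `\` A) @[h --> \oo] --> pr (V `\` A).
    rewrite /V setD_bigcupl; apply: pr_bigcup_cvg => // h k hk.
    by apply/subsetPset; apply: setSD; exact: subset_sweep.
  move/cvgrPdist_lt : cv => /(_ (pr (V `\` A) - e / 2)).
  rewrite subr_gt0 => /(_ gain)[h _ /(_ h (leqnn _))]; rewrite ltr_norml => /andP[_].
  by move=> hP; exists h; lra.
have := ex_minnP exh; case=> h hP hmin.
have hle : pr (sweep T h D `\` A) <= e / 2 + 2 * pr D.
  case: h hP hmin => [_ _|h _ /(_ h)].
    rewrite sweep0; apply: (@le_trans _ _ (pr D)); last by lra.
    by apply: pr_subset => //; exact: measurableD.
  rewrite ltnn => /contraFN /(_ erefl); rewrite -ltNge => hlt.
  by have := sweepS_le mpsT h mD mA; lra.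
exists h, D; split => //.
apply: le_trans (sweepD_le mpsT h L mD mA) _.
move: De; rewrite ltr_pdivlMr ?mulr_gt0// -(natr1 L) => De.
by lra.
Qed.

(** Beyond M, the old set A is already mixed; before M, all times c i n are
bounded by some L, so that the multiple returns of the sweep of length h + L
contain the sweep of length h.  The order of choice is what matters: M depends
on A only, and B is built after M. *)
Lemma enlargement_step A (e : R) (k : nat) : nontrivial_measure mu ->
  measurable A -> pr A <= 1 / 2 -> 0 < e -> e < 1 ->
  exists B M, [/\ measurable B /\ A `<=` B, (k <= M)%N, pr (B `\` A) <= e,
    (forall n, (absz n < M)%N ->
       e / 2 <= pr (multi_return T (c^~ n) B `\` A)) &
    forall n, (M <= absz n)%N ->
       pr A ^+ d.+1 - e / 16 <= pr (multi_return T (c^~ n) A)].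
Proof.
move=> ntX mA A2 e0 e1.
have e16 : 0 < e / 16 by lra.
have [N NP] := pr_multi_return_near mA e16.
have [L LP] := bounded_family c (maxn k N).
have [h [D [mD lo hi]]] := exists_sweep L ntX mA A2 e0 e1.
have mS j : measurable (sweep T j D) by exact: (measurable_sweep mpsT).
have mB : measurable (A `|` sweep T (h + L) D) by exact: measurableU.
exists (A `|` sweep T (h + L) D), (maxn k N); split.
- by split.
- exact: leq_maxl.
- by rewrite setDUl setDv set0U.
- move=> n nM; apply: le_trans lo _; apply: pr_subset.
  + exact: measurableD.
  + by apply: measurableD => //; exact: (measurable_multi_return mpsT).
  apply: setSD; apply: subset_trans (multi_returnS (mps_bij mpsT) (@subsetUr _ _ _)).
  by apply: (sweep_multi_return (mps_bij mpsT)) => i; exact: LP.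
- move=> n; rewrite geq_max => /andP[_ /NP].
  by rewrite ltr_norml => /andP[? _]; lra.
Qed.

End Mixing.

(** * Increasing stages with geometric increments *)

Section GeometricStages.
Context (disp : measure_display) (X : measurableType disp) (R : realType)
  (mu : probability X R) (F : nat -> set X) (e : R).
Hypotheses (mF : forall k, measurable (F k))
  (subF : forall k, F k `<=` F k.+1)
  (gapF : forall k, fine (mu (F k.+1 `\` F k)) <= e * 2^-1 ^+ k).
Local Notation pr A := (fine (mu A)).

(** The negative term is the part of the geometric series that is still to come;
it makes the induction on j go through. *)
Lemma pr_stage_le (k j : nat) :
  pr (F (k + j)) <= pr (F k) + 2 * (e * 2^-1 ^+ k) - 2 * (e * 2^-1 ^+ (k + j)).
Proof.
elim: j => [|j IH]; first by rewrite addn0; lra.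
rewrite addnS (pr_setD _ _ _ (@subF (k + j)))// [_ ^+ (k + j).+1]exprSr.
by have := gapF (k + j); lra.
Qed.

Lemma pr_bigcup_stage_le (k : nat) : 0 < e ->
  pr (\bigcup_j F j) <= pr (F k) + 2 * (e * 2^-1 ^+ k).
Proof.
move=> e0; have ndF : nondecreasing_seq F.
  by apply/nondecreasing_seqP => j; apply/subsetPset.
have cF := pr_bigcup_cvg (mu := mu) mF ndF.
rewrite -(cvg_lim (@Rhausdorff R) cF); apply: limr_le; first exact: cvgP cF.
exists k => // j /= kj; rewrite -(subnKC kj).
apply: le_trans (pr_stage_le _ _) _; rewrite lerBlDr lerDl.
by rewrite mulr_ge0// mulr_ge0 ?exprn_ge0// ltW.
Qed.

End GeometricStages.

(** * Sets returning more than independent ones *)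

Theorem theorem1p10 (R : realType) (disp : measure_display)
    (X : measurableType disp) (mu : probability X R) (T : X -> X) (d : nat)
    (c : 'I_d -> int -> int) :
  (1 <= d)%N ->
  standard_probability_space mu ->
  nontrivial_measure mu ->
  invertible_mps mu T ->
  mixing_of_order mu T d.+1 ->
  dispersing c ->
  exists A : set X, measurable A /\
    forall n : int, (mu A ^+ d.+1 < mu (multi_return T (c^~ n) A))%E.
Proof.
move=> d0 _ ntX mpsT mixT dispc.
(* All stages have measure at most 2 e, where the slope of the (d+1)-th power is
   at most (d+1) 2 e = 1 / 16. *)
pose e : R := (32 * d.+1%:R)^-1.
have e0 : 0 < e by rewrite invr_gt0 mulr_gt0.
have eE : d.+1%:R * e = 1 / 32.
  by rewrite /e invfM mulrCA mulfV ?pnatr_eq0// mulr1 div1r.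
have e32 : e <= 1 / 32 by rewrite -eE ler_peMl ?ler1n// ltW.
pose eps k : R := e * 2^-1 ^+ k.
have eps0 k : 0 < eps k by rewrite mulr_gt0// exprn_gt0.
have epsS k : eps k = 2 * eps k.+1 by rewrite /eps exprSr; lra.
have epsle k : eps k <= e by rewrite ger_pMr// exprn_ile1//; lra.
(* A total step function is needed to iterate; its values are relevant only on
   the measurable sets of measure at most 1 / 2, where the stages stay. *)
have /choice[next nextP] : forall p : nat * set X, exists q : set X * nat,
    measurable p.2 -> fine (mu p.2) <= 1 / 2 ->
    [/\ measurable q.1 /\ p.2 `<=` q.1, (p.1 <= q.2)%N,
        fine (mu (q.1 `\` p.2)) <= eps p.1,
        (forall n, (absz n < q.2)%N -> eps p.1 / 2 <=
           fine (mu (multi_return T (c^~ n) q.1 `\` p.2))) &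
        forall n, (q.2 <= absz n)%N ->
          fine (mu p.2) ^+ d.+1 - eps p.1 / 16 <=
          fine (mu (multi_return T (c^~ n) p.2))].
  move=> [k A] /=; have [[mA A2]|nA] :=
      pselect (measurable A /\ fine (mu A) <= 1 / 2); last first.
    by exists (set0, 0%N) => mA A2; case: nA.
  have e1 : eps k < 1 by have := epsle k; lra.
  have [B [M BM]] :=
    enlargement_step d0 mpsT mixT dispc k ntX mA A2 (eps0 k) e1.
  by exists (B, M).
pose stage := fix stage k := if k is j.+1 then (next (j, stage j)).1 else set0.
pose scale k := (next (k, stage k)).2.
have stageP k : measurable (stage k) /\ fine (mu (stage k)) <= 2 * e - 2 * eps k.
  elim: k => [|k [mS Sk]].
    by rewrite /= measure0 /= /eps expr0 mulr1 subrr; split.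
  have S2 : fine (mu (stage k)) <= 1 / 2 by have := eps0 k; lra.
  have [[mS' sub] _ gap _ _] := nextP (k, stage k) mS S2; split => //=.
  by rewrite (pr_setD _ _ _ sub)//; have := epsS k; lra.
have mS k : measurable (stage k) by case: (stageP k).
have S2 k : fine (mu (stage k)) <= 1 / 2.
  by have [_] := stageP k; have := eps0 k; lra.
have nextS k := nextP (k, stage k) (mS k) (S2 k).
have subS k : stage k `<=` stage k.+1 by case: (nextS k) => -[].
have gapS k : fine (mu (stage k.+1 `\` stage k)) <= eps k by case: (nextS k).
pose A := \bigcup_k stage k.
have mA : measurable A by exact: bigcupT_measurable.
have tail k : fine (mu A) <= fine (mu (stage k)) + 2 * eps k.
  exact: (pr_bigcup_stage_le mS subS gapS).
have A2e : fine (mu A) <= 2 * e.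
  by have := tail 0%N; rewrite /= measure0 /= add0r /eps expr0 mulr1.
have powA y : 0 <= y -> y <= fine (mu A) ->
    fine (mu A) ^+ d.+1 - y ^+ d.+1 <= (fine (mu A) - y) / 16.
  move=> y0 yA; apply: le_trans (exprn_sub_le d0 y0 yA _) _; first exact: pr_le1.
  rewrite mulrC ler_wpM2l ?subr_ge0//.
  apply: (@le_trans _ _ (d.+1%:R * (2 * e))); first by rewrite ler_wpM2l.
  by rewrite mulrCA eE; lra.
exists A; split => // n.
have mR B : measurable B -> measurable (multi_return T (c^~ n) B).
  exact: (measurable_multi_return mpsT).
rewrite (prE mu mA) (prE mu (mR _ mA)) -EFin_expe lte_fin.
(* The thresholds need not increase with k, but they are unbounded, and only the
   minimality of k will be used. *)
have exk : exists k, (absz n < scale k)%N.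
  by exists (absz n).+1; case: (nextS (absz n).+1).
have := ex_minnP exk; case=> k nk kmin.
have gain : eps k / 2 <= fine (mu (multi_return T (c^~ n) A `\` stage k)).
  have [_ _ _ /(_ n nk) + _] := nextS k; move/le_trans; apply; apply: pr_subset.
  - exact: measurableD (mR _ (mS k.+1)) (mS k).
  - exact: measurableD (mR _ mA) (mS k).
  - apply: setSD; apply: (multi_returnS (mps_bij mpsT)) => x Sx.
    by exists k.+1.
case: k nk kmin gain => [|j] _ kmin gain.
  have := powA 0 (lexx _) (pr_ge0 mu A); rewrite expr0n subr0 subr0.
  have : fine (mu (multi_return T (c^~ n) A `\` stage 0)) <=
         fine (mu (multi_return T (c^~ n) A)).
    by apply: pr_subset => //; [exact: measurableD (mR _ mA) (mS 0%N)|exact: mR].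
  by move: gain; rewrite /eps expr0 mulr1; lra.
(* By minimality of k = j + 1, the time n is beyond the threshold of stage j.  The
   gain is eps (j + 1) / 2; the losses are eps j / 16 = eps (j + 1) / 8 and
   2 eps j / 16 = eps (j + 1) / 4. *)
have nj : (scale j <= absz n)%N.
  by rewrite leqNgt; apply/negP => /kmin; rewrite ltnn.
have [_ _ _ _ /(_ n nj)/= old] := nextS j.
have jA : fine (mu (stage j)) <= fine (mu A).
  by apply: pr_subset => // x Sx; exists j.
have disjoint_pieces : fine (mu (multi_return T (c^~ n) (stage j))) +
    fine (mu (multi_return T (c^~ n) A `\` stage j.+1)) <=
    fine (mu (multi_return T (c^~ n) A)).
  have mD := measurableD (mR _ mA) (mS j.+1).
  rewrite -pr_setU_disjoint//; [|exact: mR|].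
    apply: pr_subset; [exact: measurableU (mR _ (mS j)) mD|exact: mR|].
    rewrite subUset; split; last exact: subDsetl.
    by apply: (multi_returnS (mps_bij mpsT)) => x Sx; exists j.
  by apply/disjoints_subset => x [/subS Sx _] [].
have := powA _ (pr_ge0 mu (stage j)) jA.
by have := tail j; have := epsS j; have := eps0 j.+1; lra.
Qed.
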